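(* Let $f:P\times X\to Y$ be a $K$-convex and $K$-closed map, let $C:P\rightrightarrows X$ be a closed and convex set-valued map, let $(\bar p,\bar x)\in \mathrm{gph}\,\mathcal S$ and $\bar y=f(\bar p,\bar x)$. Let $H:P\rightrightarrows P\times X$ be defined by $H(p)=\{p\}\times C(p)$. Suppose that (i) $\mathbb{R}^+(\mathrm{rge}\,H-\mathrm{dom}\,f)$ is a closed subspace of $P\times X$; (ii) $\mathbb{R}^+(P-\mathrm{dom}\,C)$ is a closed subspace of $P$; and that $F$ is $K$-dominated by $\mathcal F$ near $\bar p$. Then, for every $y^*\in Y^*$, $$\widehat D^*(\mathcal F+K)(\bar p,\bar y)(y^* )=\bigcup_{(p^*,x^* )\in D^*(f+K)(\bar p,\bar x)(y^* )}\Big\{p^*+D^*C(\bar p,\bar x)(x^* )\Big\}.$$ In particular, for every $y^*\in K^*$, $$\widehat D^*(\mathcal F+K)(\bar p,\bar y)(y^* )=\bigcup_{(p^*,x^* )\in \partial\langle y^*,f\rangle(\bar p,\bar x)}\Big\{p^*+D^*C(\bar p,\bar x)(x^* )\Big\}.$$ Moreover, if $f$ is continuously differentiable at $(\bar p,\bar x)$, then for every $y^*\in K^*$, $$\widehat D^*(\mathcal F+K)(\bar p,\bar y)(y^* )=\nabla_p f(\bar p,\bar x)^*(y^* )+D^*C(\bar p,\bar x)\big(\nabla_x f(\bar p,\bar x)^*(y^* )\big).$$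
   Context: $X,Y,P$ are Banach spaces with duals $X^*,Y^*,P^*$; products carry the norm $\|(x,y)\|=\|x\|+\|y\|$. $K\subseteq Y$ is a pointed, closed, convex cone with apex at the origin, and $K^*=\{y^*\in Y^*\mid \langle y^*,k\rangle\ge 0\ \forall k\in K\}$. For a set $\Omega$, $\mathbb{R}^+(\Omega)=\mathrm{cone}\,\Omega=\{\lambda a\mid \lambda\ge 0,\ a\in\Omega\}$. For a set-valued map $G:U\rightrightarrows V$ between Banach spaces: $\mathrm{dom}\,G=\{u\mid G(u)\ne\emptyset\}$, $\mathrm{gph}\,G=\{(u,v)\mid v\in G(u)\}$, $\mathrm{rge}\,G=\bigcup_{u\in U}G(u)$. $G$ is convex (closed) if $\mathrm{gph}\,G$ is convex (closed). If $V=Y$, $\mathrm{epi}\,G=\{(u,y)\mid y\in G(u)+K\}$, $G$ is $K$-convex ($K$-closed) if $\mathrm{epi}\,G$ is convex (closed), and the profile map is $(G+K)(u)=G(u)+K$, so that $\mathrm{gph}(G+K)=\mathrm{epi}\,G$. All set-valued maps are assumed proper (nonempty domain). A single-valued map is regarded as the set-valued map with singleton values. For a convex set-valued map $G$ and $(\bar u,\bar v)\in\mathrm{gph}\,G$, the coderivative is $D^*G(\bar u,\bar v)(v^* )=\{u^*\in U^*\mid (u^*,-v^* )\in N((\bar u,\bar v),\mathrm{gph}\,G)\}$ for $v^*\in V^*$, where for a convex set $\Omega$ and $\bar w\in\Omega$, $N(\bar w,\Omega)=\{w^*\mid \langle w^*,w-\bar w\rangle\le 0\ \forall w\in\Omega\}$.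 $D^*(f+K)(\bar p,\bar x)$ denotes the coderivative of $f+K$ at the point $((\bar p,\bar x),f(\bar p,\bar x))$. For an arbitrary (possibly nonconvex) $G$ and $(\bar u,\bar v)\in\mathrm{gph}\,G$, the Fréchet coderivative is $\widehat D^*G(\bar u,\bar v)(v^* )=\{u^*\in U^*\mid (u^*,-v^* )\in\widehat N((\bar u,\bar v),\mathrm{gph}\,G)\}$, where for a set $\Omega$ and $\bar w\in\Omega$, $\widehat N(\bar w,\Omega)=\{w^*\mid \limsup_{w\to\bar w,\,w\in\Omega}\frac{\langle w^*,w-\bar w\rangle}{\|w-\bar w\|}\le 0\}$. $\partial$ is the subdifferential of convex analysis and $\langle y^*,f\rangle(p,x)=\langle y^*,f(p,x)\rangle$. $\nabla_pf(\bar p,\bar x)^*$ and $\nabla_xf(\bar p,\bar x)^*$ are the adjoints of the partial derivatives. $F:P\rightrightarrows Y$ is the objective map $F(p)=\{y\in Y\mid \exists x\in C(p),\ y=f(p,x)\}$. For nonempty $A\subseteq Y$, $\mathrm{Min}_KA=\{a\in A\mid (A-a)\cap(-K\setminus\{0\})=\emptyset\}$. $\mathcal F(p)=\mathrm{Min}_KF(p)$ is the perturbation map (with $\mathcal F(p)=\emptyset$ if $F(p)=\emptyset$) and $\mathcal S(p)=\{x\in C(p)\mid f(p,x)\in\mathcal F(p)\}$ is the solution map. $F$ is $K$-dominated by $\mathcal F$ near $\bar p$ if $F(p)\subseteq\mathcal F(p)+K$ for all $p$ in some neighborhood of $\bar p$. *)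

(* Defs.v *)
From HB Require Import structures.
From mathcomp Require Import all_boot all_order all_algebra.
From mathcomp Require Import all_classical all_reals all_analysis.

Set Implicit Arguments.
Unset Strict Implicit.
Unset Printing Implicit Defensive.

Import Order.TTheory GRing.Theory Num.Theory.
Import numFieldNormedType.Exports.

Local Open Scope classical_set_scope.
Local Open Scope ring_scope.

Section sets_and_cones.
Context {R : realType} {U : normedModType R}.
Implicit Types A B K : set U.

Definition set_diff A B : set U := [set a - b | a in A & b in B].

Definition cone_hull A : set U :=
  [set l *: a | l in [set l : R | 0 <= l] & a in A].

Definition closed_subspace A : Prop := closed A /\ GRing.submod_closed [in A].

Definition pointed_closed_convex_cone K : Prop :=
  [/\ closed K, convex_set K, K 0,
      forall (l : R) k, 0 <= l -> K k -> K (l *: k)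
    & K `&` [set - k | k in K] = [set 0] ].

(* The library has no type of continuous linear functionals: the topological
   dual is the set of scalar-valued maps that are linear and continuous, with
   pointwise operations. *)
Definition dual : set (U -> R) := [set f : U -> R | scalar f /\ continuous f].

Definition dual_cone K : set (U -> R) :=
  [set f | dual f /\ forall k, K k -> 0 <= f k].

Definition normal_cone A (a : U) : set (U -> R) :=
  [set f | dual f /\ forall z, A z -> f (z - a) <= 0].

Definition subdifferential (phi : U -> R) (a : U) : set (U -> R) :=
  [set f | dual f /\ forall z, f (z - a) <= phi z - phi a].

Definition minimal_points K A : set U :=
  [set a | A a /\ [set z - a | z in A] `&` ([set - k | k in K] `\ 0) = set0].

End sets_and_cones.

Arguments dual {R} U.

Section set_valued_maps.
Context {R : realType} {U V : normedModType R}.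
Implicit Types (G : U -> set V) (K : set V).

Definition single_valued (f : U -> V) : U -> set V := fun u => [set f u].

Definition dom G : set U := [set u | G u !=set0].

Definition gph G : set (U * V) := [set z | G z.1 z.2].

Definition rge G : set V := \bigcup_(u in setT) G u.

Definition profile K G : U -> set V := fun u => [set v + k | v in G u & k in K].

Definition epi K G : set (U * V) := [set z | profile K G z.1 z.2].

Definition convex_map G : Prop := convex_set (gph G).

Definition closed_map G : Prop := closed (gph G).

Definition Kconvex K G : Prop := convex_set (epi K G).

Definition Kclosed K G : Prop := closed (epi K G).

Definition dominated_near K G G' (u : U) : Prop :=
  \forall p \near u, G p `<=` profile K G' p.

End set_valued_maps.

Section coderivatives.
Context {R : realType} {U V : normedModType R}.
Implicit Types (G : U -> set V) (A : set (U * V)).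

(* The norm u, v |-> |u| + |v|. The library's norm on a product is the maximum
   norm, which is equivalent to it: topology, closedness, differentiability
   and the dual of the product are the same for both. *)
Definition sum_norm (z : U * V) : R := `|z.1| + `|z.2|.

(* A pair (us, vs) of functionals, seen as a functional on the product. *)
Definition pair_functional (us : U -> R) (vs : V -> R) : U * V -> R :=
  fun z => us z.1 + vs z.2.

(* The image of a set of functionals on U * V under the identification of the
   dual of U * V with the product of the duals. *)
Definition dual_pairs (N : set (U * V -> R)) : set ((U -> R) * (V -> R)) :=
  [set s | [/\ dual U s.1, dual V s.2 & N (pair_functional s.1 s.2)] ].

(* The limsup is taken along the punctured neighborhoods of w in A; it is -oo
   when w is isolated in A. *)
Definition frechet_normal_cone A (w : U * V) : set (U * V -> R) :=
  [set f | dual (U * V)%type f /\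
    (limf_esup (fun z : U * V => (f (z - w) / sum_norm (z - w))%:E)
       (within A w^') <= 0)%E].

Definition coderivative G (u : U) (v : V) (vs : V -> R) : set (U -> R) :=
  [set us | dual_pairs (normal_cone (gph G) (u, v)) (us, fun z => - vs z)].

Definition frechet_coderivative G (u : U) (v : V) (vs : V -> R) :
    set (U -> R) :=
  [set us | dual_pairs (frechet_normal_cone (gph G) (u, v))
              (us, fun z => - vs z)].

Definition adjoint (T : U -> V) (vs : V -> R) : U -> R := vs \o T.

(* f is Fréchet differentiable near u, and its derivative is continuous at u
   for the operator norm. *)
Definition continuously_differentiable_at (f : U -> V) (u : U) : Prop :=
  (\forall w \near u, differentiable f w) /\
  (forall e : R, 0 < e ->
     \forall w \near u, forall h, `|'d f w h - 'd f u h| <= e * `|h|).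

End coderivatives.

Definition translate {R : realType} {U : normedModType R}
    (us : U -> R) (A : set (U -> R)) : set (U -> R) :=
  [set us \+ qs | qs in A].

Section parametric_optimization.
Context {R : realType} {P X Y : normedModType R}.
Implicit Types (K : set Y) (f : P * X -> Y) (C : P -> set X).

Definition graph_section C : P -> set (P * X) := fun p => [set p] `*` C p.

Definition objective f C : P -> set Y :=
  fun p => [set y | exists2 x, C p x & y = f (p, x)].

Definition perturbation K f C : P -> set Y :=
  fun p => minimal_points K (objective f C p).

Definition solution K f C : P -> set X :=
  fun p => [set x | C p x /\ perturbation K f C p (f (p, x))].

End parametric_optimization.

(* Main.v *)
From HB Require Import structures.
Require Import Defs.
From mathcomp Require Import all_boot all_order all_algebra.
From mathcomp Require Import all_classical all_reals all_analysis.
From mathcomp Require Import ring lra.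
Set Implicit Arguments.
Unset Strict Implicit.
Unset Printing Implicit Defensive.
Import Order.TTheory GRing.Theory Num.Theory.
Import numFieldNormedType.Exports.
Local Open Scope classical_set_scope.
Local Open Scope ring_scope.

(** Why the theorem is true.

    A pair (ps, -ys) is normal to the graph of F + K at (pbar, ybar) exactly
    when ys is in the dual cone of K and the function ys o f, which is then
    convex, minus ps attains its minimum over gph C at (pbar, xbar).  So the
    formula is the sum rule of convex analysis for ys o f and the indicator
    function of gph C, and the work is to reach a situation where it holds.

    From F + K to the perturbation map: since F is dominated by its minimal
    points near pbar, the two profile maps have the same graph near
    (pbar, ybar), and Fréchet normals depend only on the set near the point
    ([frechet_normal_cone_near]).  The graph of F + K is convex, and for a
    convex set Fréchet normals are normals, by shrinking a point of the set
    towards the base point ([frechet_normal_cone_convex]).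

    The sum rule asks for continuity of ys o f.  The closed epigraph of f is
    carried into that of ys o f by a linear map, but linear images of closed
    sets need not be closed, so continuity is drawn from the epigraph of f
    itself.  That epigraph is a closed convex subset of (P x X) x Y which
    projects onto P x X; as in the open mapping theorem, Baire's theorem and a
    geometric series of points of the epigraph give points of bounded norm
    above a whole ball ([closed_convex_bounded_section]).  As ys is nonnegative
    on K, this bounds ys o f above on that ball, hence by convexity near every
    point ([scalarization_upper_bounded]).

    The sum rule ([moreau_rockafellar]) is a separation argument.  Write u for
    (pbar, xbar), and psi for ps seen as a functional of (p, x).  The vectors
    (a - b, (ys o f)(a) - (ys o f)(u) - psi (b - u)) with b in gph C generate a
    convex cone in (P x X) x R that meets the vertical axis only in nonnegative
    heights, and a linear map lying below this cone is a subgradient with the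
    required property.  Such a map is a minimal element among the sublinear
    functions below the lower envelope of the cone ([hahn_banach_conical]); it
    is continuous because ys o f is bounded above near u.

    Splitting the subgradient into its two partial functionals gives the first
    formula.  For ys in the dual cone the coderivative of f + K is the
    subdifferential of ys o f, and where f is differentiable that
    subdifferential is the single functional ys o 'd f. *)

(** * Linear maps below a convex cone *)

Definition sublinear (R : realType) (E : lmodType R) (q : E -> R) : Prop :=
  (forall x y, q (x + y) <= q x + q y) /\
  (forall t x, 0 < t -> q (t *: x) <= t * q x).

Lemma sublinearZ (R : realType) (E : lmodType R) (q : E -> R) :
  sublinear q -> forall t x, 0 < t -> q (t *: x) = t * q x.
Proof.
move=> [_ qZ] t x t0; apply/eqP; rewrite eq_le qZ//=.
have := qZ t^-1 (t *: x); rewrite invr_gt0 => /(_ t0).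
by rewrite scalerA mulVf ?gt_eqF// scale1r ler_pdivlMl.
Qed.

Lemma sublinear0 (R : realType) (E : lmodType R) (q : E -> R) :
  sublinear q -> q 0 = 0.
Proof.
by move=> /sublinearZ /(_ 2 0 (ltr0n _ _)); rewrite scaler0 => ?; lra.
Qed.

(** [W] stands for a convex cone in [E * R] given by its vertical slices; the
    slack [c <=] allows the cone to be given up to moving points upwards. *)
Definition conical_relation (R : realType) (E : lmodType R)
    (W : E -> set R) : Prop :=
  [/\ forall x, W x !=set0,
      forall x y r s, W x r -> W y s -> exists2 c, c <= r + s & W (x + y) c,
      forall t x r, 0 < t -> W x r -> exists2 c, c <= t * r & W (t *: x) c
    & forall r, W 0 r -> 0 <= r].

(** The lower envelope is finite: adding any point of the slice over [- x] to a
    point over [x] lands over 0, where heights are nonnegative. *)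
Lemma conical_relation_inf (R : realType) (E : lmodType R) (W : E -> set R) :
  conical_relation W ->
  sublinear (fun x => inf (W x)) /\ (forall x r, W x r -> inf (W x) <= r).
Proof.
move=> [W0 WD WZ Wpos].
have Wlb x : has_lbound (W x).
  have [s Ws] := W0 (- x); exists (- s) => r Wr.
  have [c crs] := WD _ _ _ _ Wr Ws.
  by rewrite subrr => /Wpos c0; lra.
have Winf x r : W x r -> inf (W x) <= r by apply: ge_inf.
split=> //; split=> [x y|t x t0].
  rewrite -lerBlDr; apply: lb_le_inf => // r Wr.
  rewrite lerBlDr -lerBlDl; apply: lb_le_inf => // s Ws.
  have [c crs /Winf Wc] := WD _ _ _ _ Wr Ws; lra.
rewrite -ler_pdivrMl//; apply: lb_le_inf => // r Wr.
have [c ctr /Winf Wc] := WZ _ _ _ t0 Wr.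
by rewrite ler_pdivrMl//; lra.
Qed.

(** The function [z |-> inf_(t > 0) (q (z + t a) - t (q a))] is again sublinear
    and below [q]; by minimality it is [q], and its value for [t = 1] is the
    missing inequality [q x <= q (x + a) - q a]. *)
Lemma minimal_sublinear_additive (R : realType) (E : lmodType R) (q : E -> R) :
  sublinear q ->
  (forall q', sublinear q' -> (forall x, q' x <= q x) -> q' = q) ->
  forall x a, q (x + a) = q x + q a.
Proof.
move=> sq minq x a; have [qD _] := sq.
pose W z := [set q (z + t *: a) - t * q a | t in [set t : R | 0 < t]].
have [sW Wle] : sublinear (fun z => inf (W z)) /\
    (forall z r, W z r -> inf (W z) <= r).
  apply: conical_relation_inf; split=> [z|z y _ _ [t /= t0 <-] [s /= s0 <-]||].
  - by exists (q (z + 1 *: a) - 1 * q a), 1 => /=.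
  - exists (q (z + y + (t + s) *: a) - (t + s) * q a).
      have := qD (z + t *: a) (y + s *: a).
      by rewrite addrACA -scalerDl => ?; lra.
    by exists (t + s) => //=; rewrite addr_gt0.
  - move=> s z _ s0 [t /= t0 <-].
    exists (q (s *: z + (s * t) *: a) - (s * t) * q a).
      by rewrite -scalerA -scalerDr sublinearZ//; lra.
    by exists (s * t) => //=; rewrite mulr_gt0.
  - by move=> _ [t /= t0 <-]; rewrite add0r sublinearZ// subrr.
have WqE : (fun z => inf (W z)) = q.
  apply: minq => // z.
  apply: (@le_trans _ _ (q (z + 1 *: a) - 1 * q a)).
    by apply: Wle; exists 1 => /=.
  by rewrite scale1r; have := qD z a; lra.
apply/eqP; rewrite eq_le qD/= -lerBrDr -[in leLHS]WqE.
by apply: Wle; exists 1 => /=; rewrite ?scale1r ?mul1r.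
Qed.

Lemma minimal_sublinear_linear (R : realType) (E : lmodType R) (q : E -> R) :
  sublinear q ->
  (forall q', sublinear q' -> (forall x, q' x <= q x) -> q' = q) ->
  scalar q.
Proof.
move=> sq minq; have qD := minimal_sublinear_additive sq minq.
have q0 := sublinear0 sq.
have qN x : q (- x) = - q x by have := qD x (- x); rewrite subrr q0 => ?; lra.
move=> t x y; rewrite qD; congr (_ + _).
have [t0|t0|->] := ltrgt0P t.
- exact: sublinearZ.
- have := sublinearZ sq x (t := - t).
  by rewrite oppr_gt0 scaleNr qN => /(_ t0) ?; lra.
- by rewrite scale0r q0 mul0r.
Qed.

(** Zorn's lemma; a nonempty chain is bounded below by its pointwise infimum,
    which is finite and sublinear by [conical_relation_inf]: the members of the
    chain all vanish at 0, and of two members the smaller one serves for the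
    sum. *)
Lemma minimal_sublinear_exists (R : realType) (E : lmodType R) (p : E -> R) :
  sublinear p ->
  exists q, [/\ sublinear q, forall x, q x <= p x
    & forall q', sublinear q' -> (forall x, q' x <= q x) -> q' = q].
Proof.
move=> sp.
pose T := {q : E -> R | sublinear q /\ forall x, q x <= p x}.
pose le_rev (q1 q2 : T) := `[< forall x, sval q2 x <= sval q1 x >].
have [||||[q [sq qp]] qmin] := @Zorn T le_rev.
- by move=> q; apply/asboolP.
- move=> q1 q2 q3 /asboolP q12 /asboolP q23; apply/asboolP => x.
  exact: le_trans (q23 x) (q12 x).
- move=> [q1 h1] [q2 h2] /asboolP /= q12 /asboolP /= q21.
  have q1E : q1 = q2 by apply/funext => x; apply/eqP; rewrite eq_le q12 q21.
  by case: _ / q1E h2 {q12 q21} => h2; rewrite (Prop_irrelevance h1 h2).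
- move=> A Atot; have [A0|/set0P[q0 Aq0]] := eqVneq A set0.
    by exists (exist _ p (conj sp (fun x => lexx _))) => q; rewrite A0.
  pose W x := [set sval q x | q in A].
  have [sW Wle] : sublinear (fun z => inf (W z)) /\
      (forall z r, W z r -> inf (W z) <= r).
    apply: conical_relation_inf; split=> [z|z y _ _ [q1 A1 <-] [q2 A2 <-]||].
    + by exists (sval q0 z), q0.
    + have [/asboolP q12|/asboolP q21] := Atot _ _ A1 A2.
        exists (sval q2 (z + y)); last by exists q2.
        case: (svalP q2) => -[/(_ z y) + _] _; have := q12 z; lra.
      exists (sval q1 (z + y)); last by exists q1.
      case: (svalP q1) => -[/(_ z y) + _] _; have := q21 y; lra.
    + move=> t z _ t0 [q1 A1 <-]; exists (sval q1 (t *: z)); last by exists q1.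
      by case: (svalP q1) => -[_ +] _; apply.
    + by move=> _ [q1 A1 <-]; case: (svalP q1) => /sublinear0 ->.
  have Wp x : inf (W x) <= p x.
    apply: le_trans (proj2 (svalP q0) x).
    by apply: Wle; exists q0.
  exists (exist _ (fun x => inf (W x)) (conj sW Wp)) => q Aq.
  by apply/asboolP => x /=; apply: Wle; exists q.
exists q; split=> // q' sq' q'q.
have q'p x : q' x <= p x := le_trans (q'q x) (qp x).
have := qmin (exist _ q' (conj sq' q'p)).
by move=> H; have := congr1 sval (H _) => /=; apply; apply/asboolP.
Qed.

(** The Hahn-Banach theorem in separation form.  Minimality among sublinear
    functions replaces the usual maximal extension of a partial functional. *)
Theorem hahn_banach_conical (R : realType) (E : lmodType R) (W : E -> set R) :
  conical_relation W ->
  exists2 l : E -> R, scalar l & forall x r, W x r -> l x <= r.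
Proof.
move=> /conical_relation_inf[/minimal_sublinear_exists[q [sq qle qmin]] Wle].
exists q; first exact: minimal_sublinear_linear.
by move=> x r /Wle; apply: le_trans.
Qed.

(** * Continuous functionals and the sum rule for convex functions *)

Section scalar_maps.
Context (R : realType) (E : lmodType R) (l : E -> R) (ll : scalar l).

Lemma scalar_map0 : l 0 = 0.
Proof. by have := ll 1 0 0; rewrite scale1r addr0 => ?; lra. Qed.

Lemma scalar_mapD x y : l (x + y) = l x + l y.
Proof. by have := ll 1 x y; rewrite scale1r mul1r. Qed.

Lemma scalar_mapZ t x : l (t *: x) = t * l x.
Proof. by have := ll t x 0; rewrite !addr0 scalar_map0 addr0. Qed.

Lemma scalar_mapN x : l (- x) = - l x.
Proof. by rewrite -scaleN1r scalar_mapZ mulN1r. Qed.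

Lemma scalar_mapB x y : l (x - y) = l x - l y.
Proof. by rewrite scalar_mapD scalar_mapN. Qed.

End scalar_maps.

(** A one-sided bound is enough: applied to [- v] it bounds [l v] below. *)
Lemma scalar_upper_bounded_dual (R : realType) (E : normedModType R)
    (l : E -> R) (M r : R) :
  scalar l -> 0 < r -> (forall v, `|v| < r -> l v <= M) -> dual E l.
Proof.
move=> ll r0 lM; split=> // x.
have M0 : 0 <= M by have := lM 0; rewrite normr0 (scalar_map0 ll); apply.
have lW s v : 0 < s -> `|v| < r * s -> `|l v| <= M * s.
  move=> s0 vrs; have rsv w : `|w| < r * s -> l w <= M * s.
    move=> wrs; have := lM (s^-1 *: w).
    rewrite normrZ (scalar_mapZ ll) gtr0_norm ?invr_gt0//.
    by rewrite ltr_pdivrMl// ler_pdivrMl// !(mulrC s); apply.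
  by rewrite ler_norml lerNl -(scalar_mapN ll) !rsv// normrN.
apply/cvgrPdist_lt => e e0; apply/nbhs_normP.
have M10 : 0 < M + 1 by lra.
exists (r * (e / (M + 1))) => /=; first by rewrite !mulr_gt0// invr_gt0.
move=> y /= xy; rewrite -(scalar_mapB ll); apply: le_lt_trans (lW _ _ _ xy) _.
  by rewrite divr_gt0.
by rewrite mulrA ltr_pdivrMr// mulrC ltr_pM2l//; lra.
Qed.

Lemma dual_bounded (R : realType) (E : normedModType R) (l : E -> R) :
  dual E l -> exists2 M, 0 < M & forall v, `|l v| <= M * `|v|.
Proof.
move=> [ll /(_ 0)/cvgrPdist_lt/(_ 1 ltr01)/nbhs_normP[r /= r0 lr]].
have r20 : 0 < r / 2 by lra.
exists (r / 2)^-1; rewrite ?invr_gt0// => v.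
have [->|v0] := eqVneq v 0; first by rewrite (scalar_map0 ll) !normr0 mulr0.
have nv0 : 0 < `|v| by rewrite normr_gt0.
have t0 : 0 < r / 2 / `|v| by rewrite divr_gt0.
have : `|0 - (r / 2 / `|v|) *: v| < r.
  by rewrite sub0r normrN normrZ gtr0_norm// divfK ?gt_eqF//; lra.
move=> /lr /=; rewrite (scalar_map0 ll) sub0r normrN (scalar_mapZ ll).
rewrite normrM gtr0_norm//.
by rewrite mulrAC ltr_pdivrMr// mul1r -ltr_pdivlMl// => /ltW.
Qed.

(** If [psi] supports [phi] at [u] along the convex set [B], then [psi] is a
    subgradient of [phi] at [u] plus a normal to [B] at [u].  This is the
    sum rule for [phi] and the indicator function of [B], in the case where
    [phi] is finite everywhere and continuous. *)
Lemma moreau_rockafellar (R : realType) (E : normedModType R) (B : set E)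
    (phi psi : E -> R) (u : E) (M r : R) :
  (forall v w s t, 0 < s -> 0 < t -> s + t = 1 ->
    phi (s *: v + t *: w) <= s * phi v + t * phi w) ->
  (forall v w s t, 0 < s -> 0 < t -> s + t = 1 -> B v -> B w ->
    B (s *: v + t *: w)) ->
  B u -> 0 < r -> (forall v, `|v| < r -> phi (u + v) <= M) ->
  scalar psi ->
  (forall b, B b -> psi (b - u) <= phi b - phi u) ->
  exists2 xi, subdifferential phi u xi &
    forall b, B b -> psi (b - u) <= xi (b - u).
Proof.
move=> phiC BC Bu r0 phiM lpsi psiphi.
pose W x := [set c | exists a t b,
  [/\ 0 < t, B b, x = t *: (a - b) & c = t * (phi a - phi u - psi (b - u))]].
have [xi lxi xiW] : exists2 l : E -> R, scalar l & forall x c, W x c -> l x <= c.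
  apply: hahn_banach_conical; split.
  - move=> x; exists (1 * (phi (x + u) - phi u - psi (u - u))).
    by exists (x + u), 1, u; split=> //; rewrite addrK scale1r.
  - move=> x y _ _ [a [t [b [t0 Bb -> ->]]]] [a' [t' [b' [t'0 Bb' -> ->]]]].
    have tt0 : 0 < t + t' by lra.
    (* The weights that turn a sum of two points of the cone into one. *)
    pose s := t / (t + t'); pose s' := t' / (t + t').
    have s0 : 0 < s by rewrite divr_gt0.
    have s'0 : 0 < s' by rewrite divr_gt0.
    have ss' : s + s' = 1 by rewrite -mulrDl divff// gt_eqF.
    have ts : (t + t') * s = t by rewrite mulrC divfK// gt_eqF.
    have ts' : (t + t') * s' = t' by rewrite mulrC divfK// gt_eqF.
    clearbody s s'.
    exists ((t + t') * (phi (s *: a + s' *: a') - phi u -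
      psi ((s *: b + s' *: b') - u))); last first.
      exists (s *: a + s' *: a'), (t + t'), (s *: b + s' *: b').
      split=> //; first exact: BC.
      by rewrite opprD addrACA -!scalerBr [RHS]scalerDr !scalerA ts ts'.
    have -> x1 x2 : t * x1 + t' * x2 = (t + t') * (s * x1 + s' * x2).
      by rewrite mulrDr !mulrA ts ts'.
    rewrite ler_pM2l//.
    rewrite !(scalar_mapB lpsi) (scalar_mapD lpsi) !(scalar_mapZ lpsi).
    have := phiC a a' s s' s0 s'0 ss'.
    have -> : s' = 1 - s by lra.
    lra.
  - move=> t x _ t0 [a [s [b [s0 Bb -> ->]]]].
    exists (t * (s * (phi a - phi u - psi (b - u)))) => //.
    by exists a, (t * s), b; rewrite mulr_gt0// scalerA mulrA.
  - move=> _ [a [t [b [t0 Bb + ->]]]].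
    move=> /esym/eqP; rewrite scaler_eq0 gt_eqF//= subr_eq0 => /eqP ->.
    by apply: mulr_ge0; [exact: ltW | rewrite subr_ge0 psiphi].
have xile v : xi (v - u) <= phi v - phi u.
  apply: xiW; exists v, 1, u; split=> //; first by rewrite scale1r.
  by rewrite subrr (scalar_map0 lpsi) mul1r subr0.
exists xi; first split=> //.
  apply: (scalar_upper_bounded_dual (M := M - phi u) lxi r0) => v vr.
  have := xile (u + v); rewrite addrC addKr => /le_trans; apply.
  by rewrite lerB// phiM.
move=> b Bb; rewrite -[in leRHS]opprB (scalar_mapN lxi) lerNr.
by apply: xiW; exists u, 1, b; split; rewrite ?scale1r// subrr sub0r mul1r.
Qed.

(** * Closed convex sets with full projection *)

Lemma cauchy_image_lipschitz (R : realType) (U V : normedModType R) (h : U -> V)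
    (F : set_system U) :
  (forall x y, `|h x - h y| <= `|x - y|) ->
  ProperFilter F -> cauchy F -> cauchy (h @ F).
Proof.
move=> hL FF /cauchy_ballP cF; apply/cauchy_ballP => e /cF.
rewrite -ball_normE => -[[A B] /= [FA FB] AB].
exists (h @` A, h @` B).
  by split; [apply: filterS FA | apply: filterS FB] => z Hz; exists z.
move=> [_ _] /= [[x Ax <-] [y By <-]]; rewrite -ball_normE /=.
exact: le_lt_trans (hL _ _) (AB (x, y) (conj Ax By)).
Qed.

HB.instance Definition _ (R : realType) (U V : completeNormedModType R) :=
  Pointed.on (U * V)%type.

Lemma prod_complete (R : realType) (U V : completeNormedModType R)
    (F : set_system (U * V)) :
  ProperFilter F -> cauchy F -> cvg F.
Proof.
move=> FF cF.
have /cauchy_cvg/cvg_ex[/= l1 Fl1] : cauchy (fst @ F).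
  apply: cauchy_image_lipschitz cF => x y.
  by rewrite prod_normE /= le_max lexx.
have /cauchy_cvg/cvg_ex[/= l2 Fl2] : cauchy (snd @ F).
  apply: cauchy_image_lipschitz cF => x y.
  by rewrite prod_normE /= le_max lexx orbT.
apply/cvg_ex; exists (l1, l2).
suff : (fun z => (z.1, z.2)) @ F --> (l1, l2).
  by rewrite (_ : (fun z => _) = id)//; apply/funext => -[].
exact: cvg_pair.
Qed.

(** Needed on the product [P * X], where Baire's theorem is applied. *)
HB.instance Definition _ (R : realType) (U V : completeNormedModType R) :=
  Uniform_isComplete.Build (U * V)%type (@prod_complete R U V).

Lemma cvg_half_bounded (R : realType) (E : normedModType R) (v : nat -> E)
    (M : R) :
  (forall N, `|v N| <= M) -> (fun N => 2^-1 ^+ N *: v N) @ \oo --> (0 : E).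
Proof.
move=> vM.
have /cvgr0Pnorm_lt gM : geometric M (2^-1 : R) @ \oo --> (0 : R).
  by apply: cvg_geometric; rewrite gtr0_norm; lra.
apply/cvgr0Pnorm_lt => e /gM; apply: filterS => N.
apply: le_lt_trans; rewrite normrZ normrM mulrC ler_wpM2r//.
exact: le_trans (vM N) (ler_norm M).
Qed.

Lemma half_series_cvg (R : realType) (Y : completeNormedModType R)
    (y : nat -> Y) (M : R) :
  (forall k, `|y k| <= M) ->
  exists2 l, series (fun k => 2^-1 ^+ k.+1 *: y k) @ \oo --> l & `|l| <= M.
Proof.
move=> yM; have M0 : 0 <= M := le_trans (normr_ge0 _) (yM 0%N).
have yM' k : `|2^-1 ^+ k.+1 *: y k| <= 2^-1 ^+ k.+1 * M.
  by rewrite normrZ ger0_norm ?exprn_ge0 ?invr_ge0// ler_wpM2l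
    ?exprn_ge0 ?invr_ge0.
have sM N : `|series (fun k => 2^-1 ^+ k.+1 *: y k) N| <= (1 - 2^-1 ^+ N) * M.
  elim: N => [|N IH]; first by rewrite /series /= big_geq// normr0 expr0 subrr mul0r.
  rewrite seriesSr; apply: le_trans (ler_normD _ _) _.
  by apply: le_trans (lerD IH (yM' N)) _; rewrite exprS; lra.
have /cvg_ex[l yl] : cvgn (series (fun k => 2^-1 ^+ k.+1 *: y k)).
  apply: normed_cvg; apply: (series_le_cvg (v_ := geometric (2^-1 * M) 2^-1)) => //.
  - by move=> k /=.
  - by move=> k; rewrite /= !mulr_ge0// ?exprn_ge0 ?invr_ge0.
  - by move=> k; apply: le_trans (yM' k) _; rewrite exprS /=; lra.
  - by apply: is_cvg_geometric_series; rewrite gtr0_norm; lra.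
exists l => //; apply: (cvgr_to_le (cvg_norm yl)); apply: nearW => N /=.
apply: le_trans (sM N) _; rewrite -[leRHS]mul1r.
by rewrite ler_wpM2r// lerBlDr lerDl exprn_ge0.
Qed.

Lemma baire_closure_ball (R : realType) (E : completeNormedModType R)
    (S : nat -> set E) :
  (forall u, exists n, S n u) ->
  exists n a, exists2 r : R, 0 < r & forall u, `|a - u| < r -> closure (S n) u.
Proof.
move=> ST; apply: contrapT => noball.
have /Baire bE n : open (~` closure (S n)) /\ dense (~` closure (S n)).
  split; first exact/closed_openC/closed_closure.
  move=> D [a Da] oD; apply: contrapT => DS; apply: noball; exists n, a.
  have /nbhs_normP[r /= r0 rD] : nbhs a D by exact: open_nbhs_nbhs.
  exists r => // u /rD Du; apply: contrapT => Su; apply: DS.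
  by exists u.
have [u [_ uS]] := bE _ (ex_intro _ (0 : E) I) openT.
have [n Snu] := ST u.
exact: uS n I (subset_closure Snu).
Qed.

(** The Robinson-Ursescu theorem for a set-valued map with full domain, in the
    form of a bounded selection on a ball.  By Baire's theorem the points [u]
    with some [y] over [u] of norm at most [n] are dense in a ball [B(a, r)].
    A point [u] of [B(a, r / 2)] is then the sum of a series [2^-(k+1) s_k] of
    such points, and the series of the corresponding [y_k] converges because
    [Y] is complete and the [y_k] are bounded. *)
Lemma closed_convex_bounded_section (R : realType)
    (E Y : completeNormedModType R) (G : set (E * Y)) :
  closed G ->
  (forall z w s t, 0 < s -> 0 < t -> s + t = 1 -> G z -> G w ->
    G (s *: z + t *: w)) ->
  (forall u, exists y, G (u, y)) ->
  exists a M, exists2 r : R, 0 < r &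
    forall u, `|u - a| < r -> exists2 y, G (u, y) & `|y| <= M.
Proof.
move=> clG cG domG.
have [|n [a [r r0 denseS]]] :=
    @baire_closure_ball R E (fun n => [set u | exists2 y, G (u, y) & `|y| <= n%:R]).
  move=> u; have [y Guy] := domG u.
  by exists (Num.truncn `|y|).+1, y => //; exact/ltW/truncnS_gt.
have r20 : 0 < r / 2 by lra.
exists a, n%:R, (r / 2) => // u ua.
have /choice[nx nxP] : forall w, exists z, `|w - a| < r / 2 ->
    [/\ G z, `|z.2| <= n%:R & `|2 *: w - z.1 - a| < r / 2].
  move=> w; have [wa|wa] := ltP `|w - a| (r / 2); last first.
    by exists (0, 0).
  have /denseS : `|a - (2 *: w - a)| < r.
    rewrite opprB addrA -mulr2n -scaler_nat -scalerBr normrZ distrC.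
    by rewrite gtr0_norm//; lra.
  have nb : nbhs (2 *: w - a) (ball (2 *: w - a) (r / 2)) by exact: nbhsx_ballx.
  move=> /(_ _ nb)[v [[y Gvy yn]]]; rewrite -ball_normE /= => wv.
  by exists (v, y); rewrite /= addrAC.
(* [w k] is the rescaled remainder: the partial sum of the first [k] terms of
   the series is [u - 2^-k *: w k], and [w k] stays within [r / 2] of [a]. *)
pose w := fix w k := if k is k'.+1 then 2 *: w k' - (nx (w k')).1 else u.
have wa k : `|w k - a| < r / 2.
  by elim: k => //= k /nxP[].
pose s k := nx (w k).
have [l sl ln] : exists2 l, series (fun k => 2^-1 ^+ k.+1 *: (s k).2) @ \oo --> l
    & `|l| <= n%:R.
  by apply: half_series_cvg => k; have [] := nxP _ (wa k).
exists l => //.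
set eta := series _ in sl.
(* Completing a partial sum by the remaining weight [2^-N] on any point of [G]
   gives a convex combination of points of [G]. *)
have GN N z : G z -> G (u + 2^-1 ^+ N *: (z.1 - w N), eta N + 2^-1 ^+ N *: z.2).
  elim: N z => [|N IH] z Gz.
    rewrite !expr0 !scale1r /eta /series /= big_geq// add0r addrCA subrr addr0.
    by case: z Gz.
  have [Gs _ _] := nxP _ (wa N).
  have h0 : 0 < 2^-1 :> R by lra.
  have h1 : 2^-1 + 2^-1 = 1 :> R by lra.
  move: (IH _ (cG _ _ _ _ h0 h0 h1 Gs Gz)).
  rewrite /eta seriesSr /= -/(s N).
  congr (G (_, _)).
  - rewrite exprSr -scalerA; congr (_ + _ *: _).
    rewrite scalerBr scalerBr scalerA mulVf// scale1r opprB.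
    by rewrite addrCA addrA.
  - by rewrite exprSr scalerDr !scalerA addrA.
have [z Gz] : exists z, G z by have [y Gy] := domG u; exists (u, y).
suff cG' : (fun N => (u + 2^-1 ^+ N *: (z.1 - w N), eta N + 2^-1 ^+ N *: z.2)) @ \oo
    --> ((u, l) : E * Y).
  by apply: (closed_cvg G clG _ _ cG'); apply: nearW => N; exact: GN.
have zw N : `|z.1 - w N| <= `|z.1 - a| + r / 2.
  by rewrite (le_trans (ler_distD a _ _))// lerD2l distrC ltW.
apply: cvg_pair => /=.
- have := cvgD (cvg_cst u) (cvg_half_bounded zw); rewrite addr0; apply.
- have := cvgD sl (@cvg_half_bounded _ _ (fun _ => z.2) _ (fun _ => lexx _)).
  rewrite addr0; apply.
Qed.

(** * Fréchet normals and functionals on a product *)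

Lemma convex_setP (R : realType) (E : lmodType R) (A : set E) :
  convex_set A <->
  forall v w (s t : R), 0 < s -> 0 < t -> s + t = 1 ->
    A v -> A w -> A (s *: v + t *: w).
Proof.
split=> [cA v w s t s0 t0 st Av Aw|cA].
  have s1 : s <= 1 by lra.
  have := cA v w (Itv01 (ltW s0) s1); rewrite !inE => /(_ Av Aw).
  by have <- : 1 - s = t by lra.
apply/convex_setW => v w /set_mem Av /set_mem Aw l l0 l1; apply/mem_set.
by apply: (cA v w l%:num (1 - l%:num)) => //; lra.
Qed.

Lemma pair_functional_dual (R : realType) (U V : normedModType R)
    (us : U -> R) (vs : V -> R) :
  dual U us -> dual V vs -> dual (U * V)%type (pair_functional us vs).
Proof.
move=> [lus cus] [lvs cvs]; split=> [t x y|x].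
  by rewrite /pair_functional /= lus lvs; ring.
apply: cvgD; [apply: continuous_comp (cus _) | apply: continuous_comp (cvs _)].
  exact: cvg_fst.
exact: cvg_snd.
Qed.

Lemma dualN (R : realType) (U : normedModType R) (us : U -> R) :
  dual U us -> dual U (fun u => - us u).
Proof.
move=> [lus cus]; split=> [t x y|x]; first by rewrite lus; ring.
by apply: cvgN; exact: cus.
Qed.

Lemma dualD (R : realType) (U : normedModType R) (us vs : U -> R) :
  dual U us -> dual U vs -> dual U (us \+ vs).
Proof.
move=> [lus cus] [lvs cvs]; split=> [t x y|x]; first by rewrite /= lus lvs; ring.
exact: cvgD (cus x) (cvs x).
Qed.

Lemma dual_fst (R : realType) (U V : normedModType R) (xi : U * V -> R) :
  dual (U * V)%type xi -> dual U (fun u => xi (u, 0)).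
Proof.
move=> [lxi cxi]; split=> [t x y|x].
  by rewrite -lxi; congr xi; congr pair; rewrite /= scaler0 addr0.
apply: continuous_comp (cxi _); apply: cvg_pair => /=; first exact: cvg_id.
exact: cvg_cst.
Qed.

Lemma dual_snd (R : realType) (U V : normedModType R) (xi : U * V -> R) :
  dual (U * V)%type xi -> dual V (fun v => xi (0, v)).
Proof.
move=> [lxi cxi]; split=> [t x y|x].
  by rewrite -lxi; congr xi; congr pair; rewrite /= scaler0 addr0.
apply: continuous_comp (cxi _); apply: cvg_pair => /=; last exact: cvg_id.
exact: cvg_cst.
Qed.

Lemma pair_functional_split (R : realType) (U V : normedModType R)
    (xi : U * V -> R) :
  scalar xi -> pair_functional (fun u => xi (u, 0)) (fun v => xi (0, v)) = xi.
Proof.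
move=> lxi; apply/funext => -[u v]; rewrite /pair_functional /= -(scalar_mapD lxi).
by congr xi; congr pair; rewrite /= ?addr0 ?add0r.
Qed.

(** A filter containing the empty set, as arises at an isolated point, satisfies
    both sides: the upper limit is then [-oo]. *)
Lemma limf_esup_le0P (R : realType) (T : topologicalType) (g : T -> \bar R)
    (F : set_system T) : Filter F ->
  (limf_esup g F <= 0)%E <->
  forall e : R, 0 < e -> \forall z \near F, (g z <= e%:E)%E.
Proof.
move=> FF; rewrite limf_esupE; split=> [gF e e0|gF].
  have /ereal_inf_lt[_ [V FV <-] Ve] :
      (ereal_inf [set ereal_sup (g @` V) | V in F] < e%:E)%E.
    by apply: le_lt_trans gF _; rewrite lte_fin.
  apply: filterS FV => z Vz; apply: le_trans (ltW Ve).
  by apply: ereal_sup_ubound; exists z.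
apply/lee_addgt0Pr => e e0; rewrite add0e.
apply: ge_ereal_inf; exists (ereal_sup (g @` [set z | (g z <= e%:E)%E])).
  by exists [set z | (g z <= e%:E)%E] => //; exact: gF.
by apply/ereal_supP => _ [z gz <-].
Qed.

Lemma sum_norm_ge0 (R : realType) (U V : normedModType R) (z : U * V) :
  0 <= sum_norm z.
Proof. exact: addr_ge0. Qed.

Lemma frechet_normal_cone_near (R : realType) (U V : normedModType R)
    (A B : set (U * V)) (w : U * V) :
  (\forall z \near w, A z <-> B z) ->
  frechet_normal_cone A w = frechet_normal_cone B w.
Proof.
move=> AB; suff WE : within A w^' = within B w^' by rewrite /frechet_normal_cone WE.
have sub (A' B' : set (U * V)) : (\forall z \near w, A' z <-> B' z) ->
    within A' w^' `<=` within B' w^'.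
  move=> A'B' Q; rewrite /within /= /dnbhs /within /=.
  by apply: filterS2 A'B' => z A'B'z /[apply] + /A'B'z; apply.
apply/seteqP; split; apply: sub => //.
by apply: filterS AB => z [? ?].
Qed.

(** The difference quotient of a linear functional is constant along the segment
    from [w] to a point [z] of the set, so its upper limit at [w] already
    bounds the quotient at [z]. *)
Lemma frechet_normal_cone_convex (R : realType) (U V : normedModType R)
    (A : set (U * V)) (w : U * V) :
  convex_set A -> A w -> frechet_normal_cone A w = normal_cone A w.
Proof.
move=> cA Aw; apply/seteqP; split=> l [dl lA]; split=> //; last first.
  apply/limf_esup_le0P => e e0.
  rewrite near_withinE; apply: nearW => z Az; rewrite lee_fin.
  apply: le_trans (ltW e0); rewrite mulr_le0_ge0 ?lA// invr_ge0.
  exact: sum_norm_ge0.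
move=> z Az; have [ll _] := dl.
have [->|zw] := eqVneq z w; first by rewrite subrr (scalar_map0 ll).
apply/ler_addgt0Pr => e e0; rewrite add0r.
have n0 : 0 < sum_norm (z - w).
  rewrite lt_neqAle sum_norm_ge0 andbT eq_sym; apply: contra zw.
  rewrite paddr_eq0// !normr_eq0 !subr_eq0 => /andP[/eqP z1 /eqP z2].
  by case: z w z1 z2 {Az Aw lA} => z1 z2 [w1 w2] /= -> ->.
have en0 : 0 < e / sum_norm (z - w) by rewrite divr_gt0.
have /limf_esup_le0P/(_ _ en0) := lA; rewrite near_withinE /= near_withinE.
move=> /nbhs_normP[r /= r0 rP].
pose nz := `|z - w|; have nz0 : 0 < nz by rewrite normr_gt0 subr_eq0.
(* Small enough to enter the ball of radius [r], and less than 1 to stay on the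
   segment from [w] to [z]. *)
pose t := Num.min 2^-1 (r / (2 * nz)).
have t0 : 0 < t by rewrite lt_min invr_gt0 ltr0n /= divr_gt0// mulr_gt0.
have t1 : t < 1 by rewrite gt_min; apply/orP; left; lra.
have tnz : t * nz < r.
  apply: (@le_lt_trans _ _ (r / 2)); last by lra.
  rewrite -ler_pdivlMr// -mulrA -invfM ge_min; apply/orP; right.
  by rewrite lexx.
have wr : `|w - (w + t *: (z - w))| < r.
  by rewrite opprD addNKr normrN normrZ gtr0_norm.
have wA : A (w + t *: (z - w)).
  have -> : w + t *: (z - w) = t *: z + (1 - t) *: w.
    by rewrite scalerBl scale1r scalerBr addrCA.
  by move/convex_setP: cA; apply=> //; lra.
have wn : w + t *: (z - w) != w.
  by rewrite -subr_eq0 addrC addKr scaler_eq0 gt_eqF//= subr_eq0.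
have := rP _ wr wn wA; rewrite addrAC subrr add0r lee_fin (scalar_mapZ ll).
have -> : sum_norm (t *: (z - w)) = t * sum_norm (z - w).
  by rewrite /sum_norm /= !normrZ gtr0_norm// mulrDr.
by rewrite -mulf_div divff ?gt_eqF// mul1r ler_pM2r ?invr_gt0.
Qed.

(** * Profile maps and scalarization *)

Lemma cone_addr (R : realType) (Y : normedModType R) (K : set Y) k k' :
  pointed_closed_convex_cone K -> K k -> K k' -> K (k + k').
Proof.
move=> [_ cK _ KZ _] Kk Kk'.
have h0 : 0 < 2^-1 :> R by lra.
have h1 : 2^-1 + 2^-1 = 1 :> R by lra.
have := KZ 2 _ (ler0n _ _) ((convex_setP _).1 cK _ _ _ _ h0 h0 h1 Kk Kk').
by rewrite -scalerDr scalerA divff// scale1r.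
Qed.

Lemma profile_singleP (R : realType) (U Y : normedModType R) (K : set Y)
    (f : U -> Y) u y :
  profile K (single_valued f) u y <-> K (y - f u).
Proof.
split=> [[_ -> [k Kk <-]]|Ky]; first by rewrite addrC addKr.
by exists (f u) => //; exists (y - f u) => //; rewrite addrC subrK.
Qed.

Lemma profile_objectiveP (R : realType) (P X Y : normedModType R) (K : set Y)
    (f : P * X -> Y) (C : P -> set X) p y :
  profile K (objective f C) p y <-> exists2 x, C p x & K (y - f (p, x)).
Proof.
split=> [[_ [x Cx ->] [k Kk <-]]|[x Cx Ky]].
  by exists x => //; rewrite addrC addKr.
exists (f (p, x)); first by exists x.
by exists (y - f (p, x)) => //; rewrite addrC subrK.
Qed.

Lemma Kconvex_comb (R : realType) (U Y : normedModType R) (K : set Y)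
    (f : U -> Y) v w (s t : R) :
  Kconvex K (single_valued f) -> K 0 -> 0 < s -> 0 < t -> s + t = 1 ->
  K (s *: f v + t *: f w - f (s *: v + t *: w)).
Proof.
move=> cf K0 s0 t0 st.
have ef u : epi K (single_valued f) (u, f u).
  by apply/profile_singleP; rewrite subrr.
by have /profile_singleP := (convex_setP _).1 cf _ _ _ _ s0 t0 st (ef v) (ef w).
Qed.

Lemma scalarization_convex (R : realType) (U Y : normedModType R) (K : set Y)
    (f : U -> Y) (ys : Y -> R) :
  Kconvex K (single_valued f) -> K 0 -> dual_cone K ys ->
  forall v w s t, 0 < s -> 0 < t -> s + t = 1 ->
    (ys \o f) (s *: v + t *: w) <= s * (ys \o f) v + t * (ys \o f) w.
Proof.
move=> cf K0 [[lys _] ysK] v w s t s0 t0 st /=.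
have := ysK _ (Kconvex_comb v w cf K0 s0 t0 st).
by rewrite (scalar_mapB lys) (scalar_mapD lys) !(scalar_mapZ lys) subr_ge0.
Qed.

(** Boundedness on the ball [B(a, r)] is carried to [u] by convexity: [u + v] is
    the midpoint of [a + 2 v] and of the reflection of [a] in [u]. *)
Lemma scalarization_upper_bounded (R : realType) (U Y : completeNormedModType R)
    (K : set Y) (f : U -> Y) (ys : Y -> R) (u : U) :
  Kconvex K (single_valued f) -> Kclosed K (single_valued f) -> K 0 ->
  dual_cone K ys ->
  exists M, exists2 r : R, 0 < r & forall v, `|v| < r -> ys (f (u + v)) <= M.
Proof.
move=> cf clf K0 ysK; have [dys ysK0] := ysK; have [lys _] := dys.
have [a [N [r r0 aN]]] : exists a N, exists2 r : R, 0 < r &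
    forall v, `|v - a| < r -> exists2 y, epi K (single_valued f) (v, y) & `|y| <= N.
  apply: closed_convex_bounded_section => //.
    exact/convex_setP.
  by move=> v; exists (f v); apply/profile_singleP; rewrite subrr.
have [c c0 ysc] := dual_bounded dys.
have ysN v : `|v - a| < r -> ys (f v) <= c * N.
  move=> /aN[y /profile_singleP /ysK0 + yN].
  rewrite (scalar_mapB lys) subr_ge0 => /le_trans; apply.
  apply: le_trans (ler_norm _) _; apply: le_trans (ysc y) _.
  by rewrite ler_pM2l.
exists (2^-1 * ys (f (u + (u - a))) + 2^-1 * (c * N)), (r / 2); first lra.
move=> v vr.
have h0 : 0 < 2^-1 :> R by lra.
have h1 : 2^-1 + 2^-1 = 1 :> R by lra.
have := scalarization_convex cf K0 ysK (u + (u - a)) (a + 2 *: v) h0 h0 h1.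
have -> : 2^-1 *: (u + (u - a)) + 2^-1 *: (a + 2 *: v) = u + v.
  rewrite -scalerDr addrA -(addrA u) subrK -mulr2n -(scaler_nat 2 u) -scalerDr.
  by rewrite scalerA mulVf// scale1r.
move=> /= /le_trans; apply; rewrite lerD2l ler_pM2l// ysN//.
by rewrite addrC addKr normrZ gtr0_norm//; lra.
Qed.

Lemma objective_profile_convex (R : realType) (P X Y : normedModType R)
    (K : set Y) (f : P * X -> Y) (C : P -> set X) :
  pointed_closed_convex_cone K -> Kconvex K (single_valued f) ->
  convex_map C -> convex_set (gph (profile K (objective f C))).
Proof.
move=> cK cf cC; have [_ _ K0 KZ _] := cK.
apply/convex_setP => -[p y] [p' y'] s t s0 t0 st.
move=> /profile_objectiveP[x Cx Ky] /profile_objectiveP[x' Cx' Ky'].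
apply/profile_objectiveP; exists (s *: x + t *: x').
  by move/convex_setP: cC => /(_ (p, x) (p', x')); apply.
have Kf := Kconvex_comb (p, x) (p', x') cf K0 s0 t0 st.
have KZ1 := KZ _ _ (ltW s0) Ky; have KZ2 := KZ _ _ (ltW t0) Ky'.
have := cone_addr cK (cone_addr cK KZ1 KZ2) Kf.
by rewrite !scalerBr [X in X + _]addrACA -opprD addrA subrK.
Qed.

(** Domination makes the two profile maps agree near [p], since [K + K] lies in
    [K]; the common graph is convex, where both notions of normal coincide. *)
Lemma frechet_coderivative_perturbation (R : realType)
    (P X Y : normedModType R) (K : set Y) (f : P * X -> Y) (C : P -> set X)
    (p : P) (y : Y) :
  pointed_closed_convex_cone K -> Kconvex K (single_valued f) ->
  convex_map C -> perturbation K f C p y ->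
  dominated_near K (objective f C) (perturbation K f C) p ->
  frechet_coderivative (profile K (perturbation K f C)) p y =
  coderivative (profile K (objective f C)) p y.
Proof.
move=> cK cf cC [Fy _] dom.
have [_ _ K0 _ _] := cK.
have near_eq : \forall z \near (p, y),
    gph (profile K (perturbation K f C)) z <-> gph (profile K (objective f C)) z.
  have : \forall z \near (p, y),
    objective f C z.1 `<=` profile K (perturbation K f C) z.1 by exact: cvg_fst dom.
  apply: filterS => -[q v] /= Fsub; rewrite /gph /=; split.
    by move=> [a [Fa _] kv]; exists a.
  move=> [a /Fsub[b Fb [k' Kk' <-]] [k Kk <-]]; exists b => //.
  by exists (k' + k); rewrite ?addrA//; exact: cone_addr.
rewrite /frechet_coderivative (frechet_normal_cone_near near_eq).
rewrite frechet_normal_cone_convex//; first exact: objective_profile_convex.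
by exists y => //; exists 0; rewrite ?addr0.
Qed.

Lemma objective_coderivativeP (R : realType) (P X Y : normedModType R)
    (K : set Y) (f : P * X -> Y) (C : P -> set X) (p : P) (y : Y)
    (ys : Y -> R) (ps : P -> R) :
  dual Y ys ->
  coderivative (profile K (objective f C)) p y ys ps <->
  dual P ps /\ forall q x k, C q x -> K k ->
    ps (q - p) <= ys (f (q, x) + k - y).
Proof.
move=> dys; split.
  move=> [/= dps _ [_ N]]; split=> // q x k Cx Kk.
  have /N : gph (profile K (objective f C)) (q, f (q, x) + k).
    by apply/profile_objectiveP; exists x => //; rewrite addrC addKr.
  by rewrite /pair_functional /= subr_le0.
move=> [dps N]; split=> //=; first exact: dualN.
split; first exact: pair_functional_dual (dualN dys).
move=> [q v] /profile_objectiveP[x Cx Kv].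
rewrite /pair_functional /= subr_le0.
by have := N q x _ Cx Kv; rewrite (addrC (f _)) subrK.
Qed.

Lemma single_coderivativeP (R : realType) (U Y : normedModType R)
    (K : set Y) (f : U -> Y) (u : U) (ys : Y -> R) (us : U -> R) :
  dual Y ys ->
  coderivative (profile K (single_valued f)) u (f u) ys us <->
  dual U us /\ forall v k, K k -> us (v - u) <= ys (f v + k - f u).
Proof.
move=> dys; split.
  move=> [/= dps _ [_ N]]; split=> // v k Kk.
  have /N : gph (profile K (single_valued f)) (v, f v + k).
    by apply/profile_singleP; rewrite addrC addKr.
  by rewrite /pair_functional /= subr_le0.
move=> [dps N]; split=> //=; first exact: dualN.
split; first exact: pair_functional_dual (dualN dys).
move=> [v y] /profile_singleP Ky.
rewrite /pair_functional /= subr_le0.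
by have := N v _ Ky; rewrite (addrC (f v)) subrK.
Qed.

Lemma single_coderivative_subdifferential (R : realType)
    (U Y : normedModType R) (K : set Y) (f : U -> Y) (u : U) (ys : Y -> R) :
  K 0 -> dual_cone K ys ->
  coderivative (profile K (single_valued f)) u (f u) ys =
  subdifferential (ys \o f) u.
Proof.
move=> K0 [dys ysK]; have [lys _] := dys; apply/seteqP; split=> us.
  move=> /(single_coderivativeP _ _ _ _ dys)[dus N]; split=> // v /=.
  by have := N v 0 K0; rewrite addr0 (scalar_mapB lys).
move=> [dus N]; apply/single_coderivativeP => //; split=> // v k Kk.
apply: le_trans (N v) _ => /=; rewrite !(scalar_mapB lys) (scalar_mapD lys).
by rewrite lerB// lerDl ysK.
Qed.

(** * Coderivatives of the objective map *)

(** The inclusion from left to right is the sum rule; the other one is the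
    addition of two inequalities.  If the left-hand side is nonempty
    then [ys] is in the dual cone, as one sees by moving along [K] over [p]. *)
Lemma objective_coderivative (R : realType) (P X Y : completeNormedModType R)
    (K : set Y) (f : P * X -> Y) (C : P -> set X) (p : P) (x : X)
    (ys : Y -> R) :
  pointed_closed_convex_cone K -> Kconvex K (single_valued f) ->
  Kclosed K (single_valued f) -> convex_map C -> C p x -> dual Y ys ->
  coderivative (profile K (objective f C)) p (f (p, x)) ys =
  \bigcup_(s in dual_pairs
      (coderivative (profile K (single_valued f)) (p, x) (f (p, x)) ys))
    translate s.1 (coderivative C p x s.2).
Proof.
move=> cK cf clf cC Cpx dys; have [lys _] := dys; have [_ _ K0 _ _] := cK.
apply/seteqP; split=> ps.
  move=> /(objective_coderivativeP _ _ _ _ _ _ dys)[dps N].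
  have [lps _] := dps.
  have ysK : dual_cone K ys.
    split=> // k Kk; have := N p x k Cpx Kk.
    by rewrite subrr (scalar_map0 lps) (addrC (f _)) addrK.
  have [M [r r0 fM]] := scalarization_upper_bounded (p, x) cf clf K0 ysK.
  have lpsi : scalar (fun z : P * X => ps z.1) by move=> t a b /=; exact: lps.
  have BC v w s t : 0 < s -> 0 < t -> s + t = 1 -> gph C v -> gph C w ->
      gph C (s *: v + t *: w) by move: v w s t; apply/convex_setP.
  have [|xi dxi Nxi] := moreau_rockafellar
      (scalarization_convex cf K0 ysK) BC (Cpx : gph C (p, x)) r0 fM lpsi.
    move=> [q v] Cqv /=; rewrite -(scalar_mapB lys).
    by have := N q v 0 Cqv K0; rewrite addr0.
  have [[lxi cxi] _] := dxi.
  pose p1 q := xi (q, 0); pose x1 v := xi (0, v).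
  have dp1 : dual P p1 by exact: dual_fst.
  have dx1 : dual X x1 by exact: dual_snd.
  exists (p1, x1); first split=> //=.
    by rewrite pair_functional_split// single_coderivative_subdifferential.
  exists (fun q => ps q - p1 q) => /=; last by apply/funext => q /=; rewrite subrKC.
  have dqs := dualD dps (dualN dp1).
  split=> //=; first exact: dualN.
  split; first exact: pair_functional_dual dqs (dualN dx1).
  move=> [q v] /Nxi /=; rewrite -[xi](pair_functional_split lxi).
  rewrite /pair_functional /= -/(p1 _) -/(x1 _); lra.
move=> [[p1 x1] [/= dp1 dx1]].
move=> /(single_coderivativeP _ _ _ _ dys)[_ N] [qs [/= dqs _ [_ NC]] <-].
apply/objective_coderivativeP => //; split; first exact: dualD.
move=> q v k Cqv Kk; have := N (q, v) k Kk; have := NC (q, v) Cqv.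
rewrite /pair_functional /=; lra.
Qed.

Lemma directional_derivative_cvg (R : realType) (U Y : normedModType R)
    (f : U -> Y) (u h : U) (ys : Y -> R) :
  differentiable f u -> dual Y ys ->
  (fun t : R => t^-1 * (ys (f (u + t *: h)) - ys (f u))) @ 0^'+ --> ys ('d f u h).
Proof.
move=> df [lys cys].
have /cvg_dnbhs_at_right := @diff_derivable _ _ _ f u h df.
rewrite -/(derive f u h) deriveE// => /(continuous_cvg _ (cys _)).
rewrite (_ : ys \o _ = fun t => t^-1 * (ys (f (u + t *: h)) - ys (f u)))//.
apply/funext => t /=.
by rewrite (scalar_mapZ lys) (scalar_mapB lys) (addrC u).
Qed.

Lemma differential_dual (R : realType) (U Y : normedModType R) (f : U -> Y)
    (u : U) (ys : Y -> R) :
  differentiable f u -> dual Y ys -> dual U (ys \o 'd f u).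
Proof.
move=> df [lys cys]; split=> [t v w|v]; first by rewrite /= linearP lys.
by apply: continuous_comp (cys _); exact: diff_continuous.
Qed.

(** A subgradient lies below all one-sided directional derivatives, and a linear
    map below another one equals it; conversely the difference quotients of a
    convex function from [u] towards [z] lie below its increment. *)
Lemma subdifferential_differentiable (R : realType) (U Y : normedModType R)
    (f : U -> Y) (u : U) (ys : Y -> R) :
  differentiable f u -> dual Y ys ->
  (forall v w s t, 0 < s -> 0 < t -> s + t = 1 ->
    (ys \o f) (s *: v + t *: w) <= s * (ys \o f) v + t * (ys \o f) w) ->
  subdifferential (ys \o f) u = [set ys \o 'd f u].
Proof.
move=> df dys cvx; have dd := differential_dual df dys.
apply/seteqP; split=> [xi [[lxi _] Nxi]|_ ->].
  have xile h : xi h <= ys ('d f u h).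
    apply: (cvgr_to_ge (directional_derivative_cvg (h := h) df dys)).
    near=> t; have t0 : 0 < t by [].
    have := Nxi (u + t *: h); rewrite addrC addKr (scalar_mapZ lxi).
    by rewrite -ler_pdivlMl.
  apply/funext => h; apply/eqP; rewrite eq_le xile /=.
  by have := xile (- h); rewrite linearN (scalar_mapN lxi) (scalar_mapN dys.1) lerN2.
split=> // z.
apply: (cvgr_to_le (directional_derivative_cvg (h := z - u) df dys)).
near=> t; have t0 : 0 < t by [].
have t1 : t < 1 by [].
rewrite ler_pdivrMl//.
have t1' : 0 < 1 - t by lra.
have := cvx z u t (1 - t) t0 t1' (subrKC _ _).
have -> : t *: z + (1 - t) *: u = u + t *: (z - u).
  by rewrite scalerBl scale1r scalerBr addrCA.
move=> /=; lra.
Unshelve. all: by end_near. Qed.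

Lemma partial_differential_fst (R : realType) (P X Y : normedModType R)
    (f : P * X -> Y) (p : P) (x : X) :
  differentiable f (p, x) ->
  'd (fun q => f (q, x)) p = (fun h => 'd f (p, x) (h, 0)) :> (P -> Y).
Proof.
move=> df.
have di : is_diff p (fun q : P => (q, x)) (fun h : P => (h, 0 : X)).
  exact: is_diff_pair (is_diff_id p) (is_diff_cst x p).
have := @diff_comp _ _ _ _ (fun q => (q, x)) f p _ df.
rewrite diff_val; apply.
exact: ex_diff.
Qed.

Lemma partial_differential_snd (R : realType) (P X Y : normedModType R)
    (f : P * X -> Y) (p : P) (x : X) :
  differentiable f (p, x) ->
  'd (fun v => f (p, v)) x = (fun h => 'd f (p, x) (0, h)) :> (X -> Y).
Proof.
move=> df.
have di : is_diff x (fun v : X => (p, v)) (fun h : X => (0 : P, h)).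
  exact: is_diff_pair (is_diff_cst p x) (is_diff_id x).
have := @diff_comp _ _ _ _ (fun v => (p, v)) f x _ df.
rewrite diff_val; apply.
exact: ex_diff.
Qed.

Theorem theorem2 (R : realType) (P X Y : completeNormedModType R)
    (K : set Y) (f : P * X -> Y) (C : P -> set X) (pbar : P) (xbar : X) :
  pointed_closed_convex_cone K ->
  Kconvex K (single_valued f) ->
  Kclosed K (single_valued f) ->
  closed_map C ->
  convex_map C ->
  gph (solution K f C) (pbar, xbar) ->
  closed_subspace
    (cone_hull (set_diff (rge (graph_section C)) (dom (single_valued f)))) ->
  closed_subspace (cone_hull (set_diff [set: P] (dom C))) ->
  dominated_near K (objective f C) (perturbation K f C) pbar ->
  let ybar := f (pbar, xbar) in
  [/\ forall ys : Y -> R, dual Y ys ->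
        frechet_coderivative (profile K (perturbation K f C)) pbar ybar ys =
        \bigcup_(s in dual_pairs
            (coderivative (profile K (single_valued f)) (pbar, xbar) ybar ys))
          translate s.1 (coderivative C pbar xbar s.2),
      forall ys : Y -> R, dual_cone K ys ->
        frechet_coderivative (profile K (perturbation K f C)) pbar ybar ys =
        \bigcup_(s in dual_pairs (subdifferential (ys \o f) (pbar, xbar)))
          translate s.1 (coderivative C pbar xbar s.2)
    & continuously_differentiable_at f (pbar, xbar) ->
      forall ys : Y -> R, dual_cone K ys ->
        frechet_coderivative (profile K (perturbation K f C)) pbar ybar ys =
        translate (adjoint ('d (fun p : P => f (p, xbar)) pbar) ys)
          (coderivative C pbar xbar
             (adjoint ('d (fun x : X => f (pbar, x)) xbar) ys))].
Proof.
move=> cK cf clf _ cC sol _ _ dom ybar; have [_ _ K0 _ _] := cK.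
have [Cpx perty] : C pbar xbar /\ perturbation K f C pbar ybar := sol.
have part1 ys : dual Y ys ->
    frechet_coderivative (profile K (perturbation K f C)) pbar ybar ys =
    \bigcup_(s in dual_pairs
        (coderivative (profile K (single_valued f)) (pbar, xbar) ybar ys))
      translate s.1 (coderivative C pbar xbar s.2).
  move=> dys; rewrite frechet_coderivative_perturbation//.
  exact: objective_coderivative.
have part2 ys : dual_cone K ys ->
    frechet_coderivative (profile K (perturbation K f C)) pbar ybar ys =
    \bigcup_(s in dual_pairs (subdifferential (ys \o f) (pbar, xbar)))
      translate s.1 (coderivative C pbar xbar s.2).
  move=> ysK; rewrite (part1 _ ysK.1).
  by rewrite single_coderivative_subdifferential.
split; [exact: part1 | exact: part2 | move=> [/nbhs_singleton df _] ys ysK].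
have dys := ysK.1; have dd := differential_dual df dys.
rewrite part2// (subdifferential_differentiable df dys); last first.
  exact: scalarization_convex cf K0 ysK.
rewrite /adjoint partial_differential_fst// partial_differential_snd//.
suff -> : dual_pairs [set ys \o 'd f (pbar, xbar)] =
    [set (ys \o (fun h => 'd f (pbar, xbar) (h, 0)),
          ys \o (fun h => 'd f (pbar, xbar) (0, h)))].
  by rewrite bigcup_set1.
apply/seteqP; split=> [[p1 x1] [/= dp1 dx1 E]|_ ->].
  congr pair; apply/funext => h /=.
    have := congr1 (@^~ (h, 0)) E; rewrite /pair_functional /=.
    by rewrite (scalar_map0 dx1.1) addr0.
  have := congr1 (@^~ (0, h)) E; rewrite /pair_functional /=.
  by rewrite (scalar_map0 dp1.1) add0r.
split=> /=; first exact: dual_fst dd.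
  exact: dual_snd dd.
exact: pair_functional_split dd.1.
Qed.
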